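(* The ten identities (R1)–(R10) defining $R$-algebras are independent; that is, for each $j \in \{1, \dots, 10\}$ there exists an algebra $\langle T, \wedge, \vee, \rightarrow, \sim, 0, 1\rangle$ of type $(2,2,2,1,0,0)$ which satisfies (R$k$) for every $k \in \{1,\dots,10\}$ with $k \neq j$, but does not satisfy (R$j$).
   Context: All algebras $\langle T, \wedge, \vee, \rightarrow, \sim, 0, 1\rangle$ are of type $(2,2,2,1,0,0)$. An inequality $s \leq t$ between terms abbreviates the identity $s \approx s \wedge t$. The identities are: (R1) $x \wedge (y \vee z) \approx (z \wedge x) \vee (y \wedge x)$; (R2) $x \approx x \wedge 1$; (R3) $0 \approx 0 \wedge x$; (R4) $\sim\sim x \approx x$; (R5) $\sim(x \wedge y) \approx \sim x \vee \sim y$; (R6) $(x \vee y) \rightarrow z \approx (x \rightarrow z) \wedge (y \rightarrow z)$; (R7) $z \rightarrow (x \wedge y) \approx (z \rightarrow x) \wedge (z \rightarrow y)$; (R8) $((x \rightarrow y) \wedge (y \rightarrow z)) \rightarrow (x \rightarrow z) \approx 1$; (R9) $x \wedge (x \rightarrow y) \leq x \wedge (\sim x \vee y)$; (R10) $\sim(x \rightarrow y) \rightarrow (x \wedge \sim y) \approx 1$. An algebra satisfying all of (R1)–(R10) is called an $R$-algebra. *)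

(* Defs.v *)
From mathcomp Require Import all_boot.

Set Implicit Arguments.
Unset Strict Implicit.
Unset Printing Implicit Defensive.

Record algebra := Algebra {
  carrier :> Type;
  meet : carrier -> carrier -> carrier;
  join : carrier -> carrier -> carrier;
  imp  : carrier -> carrier -> carrier;
  neg  : carrier -> carrier;
  zero : carrier;
  one  : carrier }.

Inductive term :=
| Var of nat
| Meet of term & term
| Join of term & term
| Imp of term & term
| Neg of term
| Zero
| One.

Fixpoint eval (A : algebra) (v : nat -> A) (t : term) : A :=
  match t with
  | Var i => v i
  | Meet s t => meet (eval v s) (eval v t)
  | Join s t => join (eval v s) (eval v t)
  | Imp s t => imp (eval v s) (eval v t)
  | Neg s => neg (eval v s)
  | Zero => zero A
  | One => one A
  end.

Record identity := Identity { lhs : term; rhs : term }.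

Definition satisfies (A : algebra) (e : identity) : Prop :=
  forall v : nat -> A, eval v (lhs e) = eval v (rhs e).

Declare Scope term_scope.
Delimit Scope term_scope with T.
Bind Scope term_scope with term.
Notation "s `&` t" := (Meet s t) (at level 48, left associativity) : term_scope.
Notation "s `|` t" := (Join s t) (at level 52, left associativity) : term_scope.
Notation "s ==> t" := (Imp s t) : term_scope.
Notation "~` s" := (Neg s) (at level 35, right associativity) : term_scope.
Notation "0" := Zero : term_scope.
Notation "1" := One : term_scope.

Declare Scope identity_scope.
Delimit Scope identity_scope with I.
Bind Scope identity_scope with identity.
Notation "s ≈ t" := (Identity s%T t%T) (at level 70) : identity_scope.
Notation "s <= t" := (Identity s%T (Meet s%T t%T)) : identity_scope.

Local Notation x := (Var 0%N).
Local Notation y := (Var 1%N).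
Local Notation z := (Var 2%N).

Open Scope identity_scope.

Definition R1 : identity := x `&` (y `|` z) ≈ (z `&` x) `|` (y `&` x).
Definition R2 : identity := x ≈ x `&` 1.
Definition R3 : identity := 0 ≈ 0 `&` x.
Definition R4 : identity := ~` (~` x) ≈ x.
Definition R5 : identity := ~` (x `&` y) ≈ (~` x) `|` (~` y).
Definition R6 : identity := (x `|` y) ==> z ≈ (x ==> z) `&` (y ==> z).
Definition R7 : identity := z ==> (x `&` y) ≈ (z ==> x) `&` (z ==> y).
Definition R8 : identity :=
  ((x ==> y) `&` (y ==> z)) ==> (x ==> z) ≈ 1.
Definition R9 : identity :=
  x `&` (x ==> y) <= x `&` ((~` x) `|` y).
Definition R10 : identity := (~` (x ==> y)) ==> (x `&` (~` y)) ≈ 1.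

Close Scope identity_scope.

(* Only the indices 1, ..., 10 are meaningful; the value elsewhere is junk. *)
Definition R (k : nat) : identity :=
  match k with
  | 1 => R1 | 2 => R2 | 3 => R3 | 4 => R4 | 5 => R5
  | 6 => R6 | 7 => R7 | 8 => R8 | 9 => R9 | 10 => R10
  | _ => Identity Zero Zero
  end%N.

(* Main.v *)
Require Import Defs.
From mathcomp Require Import all_boot.

(** Every model is finite, so each identity is checked by evaluating it on all
    valuations.  Models with two elements separate (R1)-(R5) and (R9).  The
    other four have a De Morgan lattice as reduct: the Łukasiewicz implication
    on the three-element chain violates only (R8) and the Gödel implication
    only (R10), while (R6) and (R7) are separated on 2 × 2 and 2 × 3 by
    implications found by computer search. *)

Definition is_witness (j : nat) (A : algebra) : Prop :=
  (forall k : nat, 1 <= k <= 10 -> k <> j -> satisfies A (R k)) /\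
  ~ satisfies A (R j).

Definition env {T : Type} (a b c : T) (i : nat) : T := nth a [:: a; b; c] i.

Ltac check_identity :=
  let v := fresh in
  move=> v /=;
  repeat match goal with |- context [v ?i] => move: (v i) end;
  repeat case;
  reflexivity.

(** [a], [b], [c] are values of x, y, z that refute (R[j]). *)
Ltac check_witness a b c :=
  split;
  [ case=> [|[|[|[|[|[|[|[|[|[|[|k]]]]]]]]]]] // _ _; check_identity
  | by move/(_ (env a b c)) ].

(** Left projections turn (R1) into x ≈ z. *)
Definition model1 : algebra :=
  @Algebra bool (fun a _ => a) (fun a _ => a) (fun _ _ => true) id false true.

Lemma model1P : is_witness 1 model1.
Proof. check_witness false true true. Qed.

Definition model2 : algebra :=
  @Algebra bool (fun _ _ => false) (fun _ _ => false) (fun _ _ => false) id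
    false false.

Lemma model2P : is_witness 2 model2.
Proof. check_witness true true true. Qed.

(** 0 occurs only in (R3), so the other identities remain Boolean laws. *)
Definition model3 : algebra := @Algebra bool andb orb implb negb true true.

Lemma model3P : is_witness 3 model3.
Proof. check_witness false false false. Qed.

Definition model4 : algebra :=
  @Algebra bool andb orb implb (fun _ => false) false true.

Lemma model4P : is_witness 4 model4.
Proof. check_witness true true true. Qed.

Definition model5 : algebra :=
  @Algebra bool andb orb (fun _ _ => true) id false true.

Lemma model5P : is_witness 5 model5.
Proof. check_witness true false false. Qed.

(* The De Morgan negation that fixes both atoms: with the Boolean complement,
   (R9) would fail at x = (true, false). *)
Definition model6 : algebra :=
  @Algebra (bool * bool)
    (fun a b => (a.1 && b.1, a.2 && b.2))
    (fun a b => (a.1 || b.1, a.2 || b.2))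
    (fun a b => if a is (true, false) then (true, true)
                else (a.1 ==> b.1, a.2 ==> b.2))
    (fun a => (~~ a.2, ~~ a.1))
    (false, false) (true, true).

(** The implication is the Boolean one after sending [(true, false)] to bottom in the premise; that
    map does not preserve the join of the two atoms. *)
Lemma model6P : is_witness 6 model6.
Proof. check_witness (true, false) (false, true) (false, false). Qed.

Inductive chain3 := Bot | Mid | Top.

Definition min3 (a b : chain3) : chain3 :=
  match a, b with
  | Bot, _ | _, Bot => Bot
  | Top, c | c, Top => c
  | Mid, Mid => Mid
  end.

Definition neg3 (a : chain3) : chain3 :=
  match a with Bot => Top | Mid => Mid | Top => Bot end.

Definition max3 (a b : chain3) : chain3 := neg3 (min3 (neg3 a) (neg3 b)).

Definition lukasiewicz_imp (a b : chain3) : chain3 :=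
  match a, b with Mid, Mid => Top | _, _ => max3 (neg3 a) b end.

Definition goedel_imp (a b : chain3) : chain3 :=
  match a, b with Bot, _ | Mid, Mid => Top | _, _ => b end.

(** For a premise [(true, Bot)], the second coordinate joins contributions of both coordinates of
    the conclusion, which breaks meets. *)
Definition model7 : algebra :=
  @Algebra (bool * chain3)
    (fun a b => (a.1 && b.1, min3 a.2 b.2))
    (fun a b => (a.1 || b.1, max3 a.2 b.2))
    (fun a b => (a.1 ==> b.1,
                 if a.2 is Top then b.2
                 else if a.1 ==> b.1 then Top else max3 Mid b.2))
    (fun a => (~~ a.1, neg3 a.2))
    (false, Bot) (true, Top).

Lemma model7P : is_witness 7 model7.
Proof. check_witness (false, Top) (true, Bot) (true, Bot). Qed.

Definition model8 : algebra :=
  @Algebra chain3 min3 max3 lukasiewicz_imp neg3 Bot Top.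

(** Top → Mid and Mid → Bot both equal Mid, but Top → Bot drops to Bot. *)
Lemma model8P : is_witness 8 model8.
Proof. check_witness Top Mid Bot. Qed.

Definition model9 : algebra :=
  @Algebra bool andb orb (fun _ _ => true) negb false true.

Lemma model9P : is_witness 9 model9.
Proof. check_witness true false false. Qed.

(** The negation is the involution [neg3], not the Gödel negation, which would violate (R4). *)
Definition model10 : algebra :=
  @Algebra chain3 min3 max3 goedel_imp neg3 Bot Top.

Lemma model10P : is_witness 10 model10.
Proof. check_witness Mid Bot Bot. Qed.

Theorem lemma6 (j : nat) (hj : 1 <= j <= 10) :
  exists A : algebra,
    (forall k : nat, 1 <= k <= 10 -> k <> j -> satisfies A (R k)) /\
    ~ satisfies A (R j).
Proof.
case: j hj => [|[|[|[|[|[|[|[|[|[|[|j]]]]]]]]]]] // _.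
- by exists model1; apply: model1P.
- by exists model2; apply: model2P.
- by exists model3; apply: model3P.
- by exists model4; apply: model4P.
- by exists model5; apply: model5P.
- by exists model6; apply: model6P.
- by exists model7; apply: model7P.
- by exists model8; apply: model8P.
- by exists model9; apply: model9P.
- by exists model10; apply: model10P.
Qed.
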